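(* For any sentence $\varphi$ of $\mathbb T$, the sequent $\top\vdash\varphi$ is provable in $\mathbb T$ if and only if $\varphi$ is true in the standard model $\mathbb N$.
   Context: Coherent logic: formulas built from atomic formulas (including equalities) using only $\top,\bot,\wedge,\vee,\exists$; sequents $\varphi\vdash_{\bar x}\psi$ derived with the standard coherent deduction system. PrimRec is the set of primitive recursive function descriptions generated from $\mathsf z$ (constant $0$), $\mathsf s$ (successor), projections $\pi^n_k$, composition $\mathrm{Cn}[\mathsf h,\mathsf g_1,\dots,\mathsf g_n]$ and primitive recursion $\mathrm{Pr}[\mathsf g,\mathsf h]$. The coherent arithmetic $\mathbb T$ has a constant $\mathsf 0$, a function symbol for each element of PrimRec, and a binary predicate $<$, with axioms: $\mathsf zx=\mathsf 0$; $\pi^n_k(x_1,\dots,x_n)=x_k$; $\mathsf sx=\mathsf 0\vdash\bot$; $\mathsf sx=\mathsf sy\vdash x=y$; the defining equations of each composition and primitive recursion symbol; $x<y\dashv\vdash\exists z(x+\mathsf sz=y)$ with $+$ the PrimRec addition. Formulas may also use bounded universal quantifiers $\forall z<t\,\varphi$ ($t$ not containing $z$) with the double rule $\psi\vdash\forall z<t\,\varphi$ iff $\psi\wedge z<t\vdash\varphi$ ($z$ not free in $\psi$), and $\mathbb T$ has the induction rules (IndR): from $\psi(\bar x)\vdash\varphi(\bar x,\mathsf 0)$ and $\psi(\bar x)\wedge\varphi(\bar x,y)\vdash\varphi(\bar x,\mathsf sy)$ infer $\psi(\bar x)\vdash_{\bar x,y}\varphi(\bar x,y)$; (IndL): from $\psi(\bar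 x,\mathsf 0)\vdash\varphi(\bar x)$ and $\psi(\bar x,\mathsf sy)\vdash\varphi(\bar x)\vee\psi(\bar x,y)$ infer $\psi(\bar x,y)\vdash_{\bar x,y}\varphi(\bar x)$. The standard model interprets everything in $\mathbb N$ in the usual way. *)

(* Defs.v *)
From mathcomp Require Import all_boot.

Set Implicit Arguments.
Unset Strict Implicit.
Unset Printing Implicit Defensive.

(** Tuples [v_0, ..., v_(n-1)] are functions on ['I_n]; [snoc v a] is
    [v_0, ..., v_(n-1), a]. *)
Definition snoc (T : Type) (n : nat) (v : 'I_n -> T) (a : T) : 'I_n.+1 -> T :=
  fun i => if unlift ord_max i is Some j then v j else a.

(** The index of [primrec] is the arity. Recursion is on the last argument:
    [Pr[g,h](x,0) = g(x)] and [Pr[g,h](x,y+1) = h(x,y,Pr[g,h](x,y))].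
    As the initial functions have positive arity, [primrec 0] is empty. *)
Inductive primrec : nat -> Type :=
| PRzero : primrec 1
| PRsucc : primrec 1
| PRproj (n : nat) (k : 'I_n) : primrec n
| PRcomp (m n : nat) (h : primrec n) (g : {ffun 'I_n -> primrec m}) : primrec m
| PRrec (n : nat) (g : primrec n) (h : primrec n.+2) : primrec n.+1.

(** [x + 0 = x] and [x + s y = s (x + y)]. *)
Definition PRadd : primrec 2 :=
  PRrec (PRproj (ord0 : 'I_1))
        (PRcomp PRsucc [ffun=> PRproj (ord_max : 'I_3)]).

(** [term n] and [form n] are the terms and formulas in a context of [n]
    variables [x_0, ..., x_(n-1)]. A quantifier extends the context at its end:
    in [Ex phi] and [BAll t phi] with [phi : form n.+1], the bound variable is
    [Var ord_max]. The bound [t] of [BAll t phi] lives in the outer context, so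
    it does not contain the bound variable. *)
Inductive term (n : nat) : Type :=
| Var (i : 'I_n)
| Zero
| App (m : nat) (f : primrec m) (ts : {ffun 'I_m -> term n}).

Arguments Zero {n}.

Inductive form : nat -> Type :=
| Top (n : nat) : form n
| Bot (n : nat) : form n
| Eq (n : nat) (t u : term n) : form n
| Lt (n : nat) (t u : term n) : form n
| And (n : nat) (phi psi : form n) : form n
| Or (n : nat) (phi psi : form n) : form n
| Ex (n : nat) (phi : form n.+1) : form n
| BAll (n : nat) (t : term n) (phi : form n.+1) : form n.

Arguments Top {n}.
Arguments Bot {n}.

Definition app (n m : nat) (f : primrec m) (ts : 'I_m -> term n) : term n :=
  App f [ffun i => ts i].

Definition app1 (n : nat) (f : primrec 1) (t : term n) : term n :=
  app f (fun=> t).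

Definition app2 (n : nat) (f : primrec 2) (t u : term n) : term n :=
  app f (snoc (fun=> t) u).

Definition Succ (n : nat) (t : term n) : term n := app1 PRsucc t.

Fixpoint tsubst (n m : nat) (s : 'I_n -> term m) (t : term n) : term m :=
  match t with
  | Var i => s i
  | Zero => Zero
  | App k f ts => App f [ffun i => tsubst s (ts i)]
  end.

Definition wkvar (n : nat) (i : 'I_n) : term n.+1 := Var (lift ord_max i).

Definition twk (n : nat) (t : term n) : term n.+1 := tsubst (@wkvar n) t.

Definition up (n m : nat) (s : 'I_n -> term m) : 'I_n.+1 -> term m.+1 :=
  snoc (fun i => twk (s i)) (Var ord_max).

Fixpoint fsubst (n m : nat) (s : 'I_n -> term m) (phi : form n) : form m :=
  match phi in form n return ('I_n -> term m) -> form m with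
  | Top _ => fun=> Top
  | Bot _ => fun=> Bot
  | Eq _ t u => fun s => Eq (tsubst s t) (tsubst s u)
  | Lt _ t u => fun s => Lt (tsubst s t) (tsubst s u)
  | And _ phi psi => fun s => And (fsubst s phi) (fsubst s psi)
  | Or _ phi psi => fun s => Or (fsubst s phi) (fsubst s psi)
  | Ex _ phi => fun s => Ex (fsubst (up s) phi)
  | BAll _ t phi => fun s => BAll (tsubst s t) (fsubst (up s) phi)
  end s.

(** A formula in the context [x] seen in the context [x, y]. *)
Definition fwk (n : nat) (phi : form n) : form n.+1 := fsubst (@wkvar n) phi.

(** [phi(x, t(x))] in the context [x], for [phi] in the context [x, y]. *)
Definition inst (n : nat) (phi : form n.+1) (t : term n) : form n :=
  fsubst (snoc (@Var n) t) phi.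

(** [phi(x, s y)] in the context [x, y], for [phi] in the context [x, y]. *)
Definition inst_succ (n : nat) (phi : form n.+1) : form n.+1 :=
  fsubst (snoc (@wkvar n) (Succ (Var ord_max))) phi.

(** [axiomT phi psi] : the sequent [phi |- psi], in the context given by the
    type of [phi] and [psi], is a non-logical axiom. *)
Inductive axiomT : forall n : nat, form n -> form n -> Prop :=
| ax_zero :
    @axiomT 1 Top (Eq (app1 PRzero (Var ord0)) Zero)
| ax_proj (n : nat) (k : 'I_n) :
    @axiomT n Top (Eq (app (PRproj k) (@Var n)) (Var k))
| ax_succ_neq0 :
    @axiomT 1 (Eq (Succ (Var ord0)) Zero) Bot
| ax_succ_inj :
    @axiomT 2 (Eq (Succ (Var ord0)) (Succ (Var ord_max)))
              (Eq (Var ord0) (Var ord_max))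
| ax_comp (m n : nat) (h : primrec n) (g : {ffun 'I_n -> primrec m}) :
    @axiomT m Top (Eq (app (PRcomp h g) (@Var m))
                      (app h (fun i => app (g i) (@Var m))))
| ax_rec0 (n : nat) (g : primrec n) (h : primrec n.+2) :
    @axiomT n Top (Eq (app (PRrec g h) (snoc (@Var n) Zero))
                      (app g (@Var n)))
| ax_recS (n : nat) (g : primrec n) (h : primrec n.+2) :
    @axiomT n.+1 Top
      (Eq (app (PRrec g h) (snoc (@wkvar n) (Succ (Var ord_max))))
          (app h (snoc (@Var n.+1) (app (PRrec g h) (@Var n.+1)))))
| ax_lt_ex :
    @axiomT 2 (Lt (Var ord0) (Var ord_max))
      (Ex (Eq (app2 PRadd (twk (Var ord0)) (Succ (Var ord_max)))
              (twk (Var ord_max))))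
| ax_ex_lt :
    @axiomT 2
      (Ex (Eq (app2 PRadd (twk (Var ord0)) (Succ (Var ord_max)))
              (twk (Var ord_max))))
      (Lt (Var ord0) (Var ord_max)).

Reserved Notation "phi |-[ n ] psi"
  (at level 70, n at level 50, psi at next level, format "phi  |-[ n ]  psi").

(** [phi |-[n] psi] : the sequent [phi |- psi] in the context
    [x_0, ..., x_(n-1)] is provable. The logical rules are the sequent rules of
    coherent logic in context, with the distributivity and Frobenius axioms. *)
Inductive entails : forall n : nat, form n -> form n -> Prop :=
| ent_axiom n (phi psi : form n) :
    axiomT phi psi -> phi |-[n] psi
| ent_id n (phi : form n) :
    phi |-[n] phi
| ent_subst n m (s : 'I_n -> term m) (phi psi : form n) :
    phi |-[n] psi -> fsubst s phi |-[m] fsubst s psi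
| ent_cut n (phi psi chi : form n) :
    phi |-[n] psi -> psi |-[n] chi -> phi |-[n] chi
| ent_eq_refl n (t : term n) :
    Top |-[n] Eq t t
| ent_eq_subst n (t u : term n) (phi : form n.+1) :
    And (Eq t u) (inst phi t) |-[n] inst phi u
| ent_top n (phi : form n) :
    phi |-[n] Top
| ent_and_l n (phi psi : form n) :
    And phi psi |-[n] phi
| ent_and_r n (phi psi : form n) :
    And phi psi |-[n] psi
| ent_and n (phi psi chi : form n) :
    phi |-[n] psi -> phi |-[n] chi -> phi |-[n] And psi chi
| ent_bot n (phi : form n) :
    Bot |-[n] phi
| ent_or_l n (phi psi : form n) :
    phi |-[n] Or phi psi
| ent_or_r n (phi psi : form n) :
    psi |-[n] Or phi psi
| ent_or n (phi psi chi : form n) :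
    phi |-[n] chi -> psi |-[n] chi -> Or phi psi |-[n] chi
| ent_distr n (phi psi chi : form n) :
    And phi (Or psi chi) |-[n] Or (And phi psi) (And phi chi)
| ent_ex n (phi : form n.+1) (psi : form n) :
    phi |-[n.+1] fwk psi -> Ex phi |-[n] psi
| ent_ex_inv n (phi : form n.+1) (psi : form n) :
    Ex phi |-[n] psi -> phi |-[n.+1] fwk psi
| ent_frobenius n (phi : form n) (psi : form n.+1) :
    And phi (Ex psi) |-[n] Ex (And (fwk phi) psi)
| ent_ball n (t : term n) (phi : form n.+1) (psi : form n) :
    And (fwk psi) (Lt (Var ord_max) (twk t)) |-[n.+1] phi ->
    psi |-[n] BAll t phi
| ent_ball_inv n (t : term n) (phi : form n.+1) (psi : form n) :
    psi |-[n] BAll t phi ->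
    And (fwk psi) (Lt (Var ord_max) (twk t)) |-[n.+1] phi
| ent_indR n (psi : form n) (phi : form n.+1) :
    psi |-[n] inst phi Zero ->
    And (fwk psi) phi |-[n.+1] inst_succ phi ->
    fwk psi |-[n.+1] phi
| ent_indL n (psi : form n.+1) (phi : form n) :
    inst psi Zero |-[n] phi ->
    inst_succ psi |-[n.+1] Or (fwk phi) psi ->
    psi |-[n.+1] fwk phi
where "phi |-[ n ] psi" := (@entails n phi psi).

Fixpoint PReval (n : nat) (f : primrec n) : ('I_n -> nat) -> nat :=
  match f in primrec n return ('I_n -> nat) -> nat with
  | PRzero => fun=> 0
  | PRsucc => fun v => (v ord0).+1
  | PRproj n k => fun v => v k
  | PRcomp m n h g => fun v => PReval h (fun i => PReval (g i) v)
  | PRrec n g h => fun v =>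
      let x := fun i => v (lift ord_max i) in
      nat_rect (fun=> nat) (PReval g x)
        (fun y r => PReval h (snoc (snoc x y) r)) (v ord_max)
  end.

Fixpoint teval (n : nat) (v : 'I_n -> nat) (t : term n) : nat :=
  match t with
  | Var i => v i
  | Zero => 0
  | App m f ts => PReval f (fun i => teval v (ts i))
  end.

Fixpoint sat (n : nat) (v : 'I_n -> nat) (phi : form n) : Prop :=
  match phi in form n return ('I_n -> nat) -> Prop with
  | Top _ => fun=> True
  | Bot _ => fun=> False
  | Eq _ t u => fun v => teval v t = teval v u
  | Lt _ t u => fun v => teval v t < teval v u
  | And _ phi psi => fun v => sat v phi /\ sat v psi
  | Or _ phi psi => fun v => sat v phi \/ sat v psi
  | Ex _ phi => fun v => exists a : nat, sat (snoc v a) phi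
  | BAll _ t phi => fun v =>
      forall a : nat, a < teval v t -> sat (snoc v a) phi
  end v.

Definition sentence : Type := form 0.

Definition provable (phi : sentence) : Prop := Top |-[0] phi.

(** The value [0] is never used, since ['I_0] is empty. *)
Definition true_in_N (phi : sentence) : Prop := sat (fun _ : 'I_0 => 0) phi.

(* Main.v *)
From Stdlib Require Import FunctionalExtensionality Setoid.
From mathcomp Require Import all_boot.
Require Import Defs.

Set Implicit Arguments.
Unset Strict Implicit.
Unset Printing Implicit Defensive.

(** Soundness is an induction on derivations. For completeness, each primitive
    recursive symbol applied to numerals provably equals the numeral of its
    value, by induction on its description. Hence every formula true at [v]
    becomes provable once the numerals of [v] are substituted, by induction on
    the formula; the bounded quantifier [BAll k phi] reduces to its [k] instances
    because [z < k + 1] entails [z < k] or [z = k]. *)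

(** * Substitution *)

Lemma snoc_max (T : Type) n (v : 'I_n -> T) a : snoc v a ord_max = a.
Proof. by rewrite /snoc unlift_none. Qed.

Lemma snoc_lift (T : Type) n (v : 'I_n -> T) a i :
  snoc v a (lift ord_max i) = v i.
Proof. by rewrite /snoc liftK. Qed.

Lemma lift_max_ord0 n : (ord0 : 'I_n.+2) = lift ord_max (ord0 : 'I_n.+1).
Proof. exact: val_inj. Qed.

Lemma snoc_ord0 (T : Type) n (v : 'I_n.+1 -> T) a : snoc v a ord0 = v ord0.
Proof. by rewrite lift_max_ord0 snoc_lift. Qed.

Lemma ord1_max (i : 'I_1) : i = ord_max.
Proof. by rewrite ord1; apply: val_inj. Qed.

Lemma snoc1 (T : Type) (v : 'I_0 -> T) a i : snoc v a i = a.
Proof. by rewrite (ord1_max i) snoc_max. Qed.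

Lemma snoc_ext (T : Type) n (f g : 'I_n.+1 -> T) :
  (forall i, f (lift ord_max i) = g (lift ord_max i)) ->
  f ord_max = g ord_max -> f = g.
Proof.
move=> fgl fgm; apply: functional_extensionality => i.
by case: (unliftP ord_max i) => [j ->|->].
Qed.

Lemma snocK (T : Type) n (v : 'I_n -> T) a :
  (fun i => snoc v a (lift ord_max i)) = v.
Proof. by apply: functional_extensionality => i; rewrite snoc_lift. Qed.

(** Pushes substitution, evaluation and numeral formation through the extension of a tuple by one
    entry, as needed for every symbol applied to an extended tuple. *)
Lemma comp_snoc (T U : Type) (f : T -> U) n (v : 'I_n -> T) a :
  (fun i => f (snoc v a i)) = snoc (fun i => f (v i)) (f a).
Proof. by apply: snoc_ext => [i|]; rewrite ?snoc_lift ?snoc_max. Qed.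

Lemma snoc_eta (T : Type) n (v : 'I_n.+1 -> T) :
  snoc (fun i => v (lift ord_max i)) (v ord_max) = v.
Proof. by apply: snoc_ext => [i|]; rewrite ?snoc_lift ?snoc_max. Qed.

(** The arguments of a symbol sit inside a finite function, so the induction hypothesis for each of
    them is produced by an explicit recursive call on [ts i]. *)
Fixpoint term_nested_ind (n : nat) (P : term n -> Prop)
    (Pvar : forall i, P (Var i)) (Pzero : P Zero)
    (Papp : forall m (f : primrec m) (ts : {ffun 'I_m -> term n}),
       (forall i, P (ts i)) -> P (App f ts)) (t : term n) : P t :=
  match t with
  | Var i => Pvar i
  | Zero => Pzero
  | App m f ts =>
      Papp m f ts (fun i => term_nested_ind Pvar Pzero Papp (ts i))
  end.

(** The same device for descriptions: in [PRcomp h g] the inner functions are nested in the finite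
    function [g]. *)
Fixpoint primrec_nested_ind (P : forall n, primrec n -> Prop)
    (Pzero : P 1 PRzero) (Psucc : P 1 PRsucc)
    (Pproj : forall n (k : 'I_n), P n (PRproj k))
    (Pcomp : forall m n (h : primrec n) (g : {ffun 'I_n -> primrec m}),
       P n h -> (forall i, P m (g i)) -> P m (PRcomp h g))
    (Prec : forall n (g : primrec n) (h : primrec n.+2),
       P n g -> P n.+2 h -> P n.+1 (PRrec g h))
    (n : nat) (f : primrec n) : P n f :=
  let IH := primrec_nested_ind Pzero Psucc Pproj Pcomp Prec in
  match f with
  | PRzero => Pzero
  | PRsucc => Psucc
  | PRproj n k => Pproj n k
  | PRcomp m n h g => Pcomp m n h g (IH n h) (fun i => IH m (g i))
  | PRrec n g h => Prec n g h (IH n g) (IH n.+2 h)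
  end.

Lemma app_ffun n m (f : primrec m) (ts : {ffun 'I_m -> term n}) :
  App f ts = app f ts.
Proof. by congr App; apply/ffunP => i; rewrite ffunE. Qed.

Lemma tsubst_app n m (s : 'I_n -> term m) k (f : primrec k) ts :
  tsubst s (app f ts) = app f (fun i => tsubst s (ts i)).
Proof. by congr App; apply/ffunP => i; rewrite !ffunE. Qed.

Lemma tsubst_app1 n m (s : 'I_n -> term m) f t :
  tsubst s (app1 f t) = app1 f (tsubst s t).
Proof. exact: tsubst_app. Qed.

Lemma tsubst_Succ n m (s : 'I_n -> term m) t :
  tsubst s (Succ t) = Succ (tsubst s t).
Proof. exact: tsubst_app. Qed.

Lemma tsubst_app2 n m (s : 'I_n -> term m) f t u :
  tsubst s (app2 f t u) = app2 f (tsubst s t) (tsubst s u).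
Proof. by rewrite /app2 tsubst_app comp_snoc. Qed.

Lemma tsubst_comp n m k (s : 'I_m -> term k) (r : 'I_n -> term m) t :
  tsubst s (tsubst r t) = tsubst (fun i => tsubst s (r i)) t.
Proof.
elim/term_nested_ind: t => //= l f ts IH.
by congr App; apply/ffunP => i; rewrite !ffunE.
Qed.

Lemma tsubst_id n (t : term n) : tsubst (@Var n) t = t.
Proof.
elim/term_nested_ind: t => //= l f ts IH.
by congr App; apply/ffunP => i; rewrite ffunE.
Qed.

Lemma tsubst_snoc_twk n m (s : 'I_n -> term m) u t :
  tsubst (snoc s u) (twk t) = tsubst s t.
Proof.
rewrite /twk tsubst_comp; congr tsubst.
by apply: functional_extensionality => i /=; rewrite snoc_lift.
Qed.

Lemma inst_twk n (u t : term n) : tsubst (snoc (@Var n) u) (twk t) = t.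
Proof. by rewrite tsubst_snoc_twk tsubst_id. Qed.

Lemma tsubst_up_twk n m (s : 'I_n -> term m) t :
  tsubst (up s) (twk t) = twk (tsubst s t).
Proof. by rewrite /up tsubst_snoc_twk /twk tsubst_comp. Qed.

Lemma up_comp n m k (s : 'I_m -> term k) (r : 'I_n -> term m) :
  (fun i => tsubst (up s) (up r i)) = up (fun i => tsubst s (r i)).
Proof.
apply: snoc_ext => [i|]; rewrite /up ?snoc_lift ?snoc_max ?tsubst_up_twk //=.
by rewrite snoc_max.
Qed.

(** The contexts and substitutions are quantified after [phi] because each quantifier replaces [s]
    and [r] by [up s] and [up r]. *)
Lemma fsubst_comp n (phi : form n) : forall m k (s : 'I_m -> term k) r,
  fsubst s (fsubst r phi) = fsubst (fun i => tsubst s (r i)) phi.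
Proof.
elim: phi => //= {n}.
- by move=> n t u m k s r; rewrite !tsubst_comp.
- by move=> n t u m k s r; rewrite !tsubst_comp.
- by move=> n phi IH1 psi IH2 m k s r; rewrite IH1 IH2.
- by move=> n phi IH1 psi IH2 m k s r; rewrite IH1 IH2.
- by move=> n phi IH m k s r; rewrite IH up_comp.
- by move=> n t phi IH m k s r; rewrite IH up_comp tsubst_comp.
Qed.

Lemma up_Var n : up (@Var n) = @Var n.+1.
Proof. by apply: snoc_ext => [i|]; rewrite /up ?snoc_lift ?snoc_max. Qed.

Lemma fsubst_id n (phi : form n) : fsubst (@Var n) phi = phi.
Proof.
elim: phi => //= {n}.
- by move=> n t u; rewrite !tsubst_id.
- by move=> n t u; rewrite !tsubst_id.
- by move=> n phi IH1 psi IH2; rewrite IH1 IH2.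
- by move=> n phi IH1 psi IH2; rewrite IH1 IH2.
- by move=> n phi IH; rewrite up_Var IH.
- by move=> n t phi IH; rewrite up_Var IH tsubst_id.
Qed.

Lemma inst_fwk n (phi : form n) t : inst (fwk phi) t = phi.
Proof.
rewrite /inst /fwk fsubst_comp -[RHS]fsubst_id; congr fsubst.
by apply: functional_extensionality => i /=; rewrite snoc_lift.
Qed.

(** Lets an instance of a quantified formula be taken after a substitution has passed under the
    quantifier; completeness uses it with numerals. *)
Lemma inst_up n m (s : 'I_n -> term m) phi t :
  inst (fsubst (up s) phi) t = fsubst (snoc s t) phi.
Proof.
rewrite /inst fsubst_comp; congr fsubst.
apply: snoc_ext => [i|]; rewrite /up ?snoc_lift ?snoc_max ?inst_twk //=.
by rewrite snoc_max.
Qed.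

(** * Soundness *)

Lemma teval_tsubst n m (s : 'I_n -> term m) v t :
  teval v (tsubst s t) = teval (fun i => teval v (s i)) t.
Proof.
elim/term_nested_ind: t => //= l f ts IH.
by congr PReval; apply: functional_extensionality => i; rewrite ffunE.
Qed.

Lemma teval_app n m (v : 'I_n -> nat) (f : primrec m) ts :
  teval v (app f ts) = PReval f (fun i => teval v (ts i)).
Proof.
by rewrite /=; congr PReval; apply: functional_extensionality => i; rewrite ffunE.
Qed.

Lemma teval_twk n (v : 'I_n -> nat) a t : teval (snoc v a) (twk t) = teval v t.
Proof.
rewrite teval_tsubst; congr teval.
by apply: functional_extensionality => i /=; rewrite snoc_lift.
Qed.

Lemma teval_up n m (s : 'I_n -> term m) v a :
  (fun i => teval (snoc v a) (up s i)) = snoc (fun i => teval v (s i)) a.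
Proof.
apply: snoc_ext => [i|]; rewrite /up ?snoc_lift ?snoc_max ?teval_twk //=.
by rewrite snoc_max.
Qed.

Lemma sat_fsubst n (phi : form n) : forall m (s : 'I_n -> term m) v,
  sat v (fsubst s phi) <-> sat (fun i => teval v (s i)) phi.
Proof.
elim: phi => //= {n}.
- by move=> n t u m s v; rewrite !teval_tsubst.
- by move=> n t u m s v; rewrite !teval_tsubst.
- by move=> n phi IH1 psi IH2 m s v; rewrite IH1 IH2.
- by move=> n phi IH1 psi IH2 m s v; rewrite IH1 IH2.
- move=> n phi IH m s v; split=> -[a Ha]; exists a; move: Ha;
  by rewrite IH teval_up.
- move=> n t phi IH m s v; rewrite teval_tsubst; split=> H a /H;
  by rewrite IH teval_up.
Qed.

Lemma sat_fwk n (phi : form n) v a : sat (snoc v a) (fwk phi) <-> sat v phi.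
Proof.
rewrite sat_fsubst; have -> // : (fun i => teval (snoc v a) (wkvar i)) = v.
by apply: functional_extensionality => i /=; rewrite snoc_lift.
Qed.

Lemma sat_inst n (phi : form n.+1) t v :
  sat v (inst phi t) <-> sat (snoc v (teval v t)) phi.
Proof. by rewrite sat_fsubst (comp_snoc (teval v)). Qed.

Lemma sat_inst_succ n (phi : form n.+1) v a :
  sat (snoc v a) (inst_succ phi) <-> sat (snoc v a.+1) phi.
Proof.
rewrite sat_fsubst (comp_snoc (teval (snoc v a))) teval_app /= snoc_max.
by rewrite snocK.
Qed.

Lemma PReval_rec0 n (g : primrec n) h x :
  PReval (PRrec g h) (snoc x 0) = PReval g x.
Proof. by rewrite /= snoc_max snocK. Qed.

Lemma PReval_recS n (g : primrec n) h x y :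
  PReval (PRrec g h) (snoc x y.+1) =
  PReval h (snoc (snoc x y) (PReval (PRrec g h) (snoc x y))).
Proof. by rewrite /= !snoc_max !snocK. Qed.

Lemma PReval_PRadd v : PReval PRadd v = v ord0 + v ord_max.
Proof.
rewrite /PRadd /=.
rewrite (_ : lift ord_max ord0 = ord0) ?ffunE /=; last exact: val_inj.
elim: (v ord_max) => [|k IH] /=; first by rewrite addn0.
by rewrite snoc_max IH addnS.
Qed.

Lemma teval_PRadd n (v : 'I_n -> nat) t u :
  teval v (app2 PRadd t u) = teval v t + teval v u.
Proof. by rewrite teval_app PReval_PRadd snoc_ord0 snoc_max. Qed.

Lemma axiomT_sound n (phi psi : form n) v : axiomT phi psi -> sat v phi -> sat v psi.
Proof.
move=> ax; case: ax v => {n phi psi}.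
- by [].
- by move=> n k v _; rewrite /= ffunE.
- by move=> v; rewrite /= ffunE.
- by move=> v; rewrite /= !ffunE => -[].
- move=> m n h g v _; rewrite /sat !teval_app; apply: (congr1 (PReval h)).
  by apply: functional_extensionality => i; rewrite teval_app.
- move=> n g h v _; rewrite /sat !teval_app (comp_snoc (teval v)).
  exact: PReval_rec0.
- move=> n g h v _; rewrite /sat !teval_app !(comp_snoc (teval v)) !teval_app.
  have := PReval_recS g h (fun i => v (lift ord_max i)) (v ord_max).
  by rewrite snoc_eta.
(* The axiom asks for z with x + (z + 1) = y, hence z = y - (x + 1). *)
- move=> v vlt; exists (v ord_max - (v ord0).+1); move: vlt.
  rewrite /sat !teval_twk teval_PRadd teval_twk => vlt.
  by rewrite teval_app /= snoc_max addnS -addSn subnKC.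
- move=> v [a]; rewrite /sat !teval_twk teval_PRadd teval_twk.
  by rewrite teval_app /= snoc_max => <-; rewrite addnS ltnS leq_addr.
Qed.

Lemma entails_sound n (phi psi : form n) :
  phi |-[n] psi -> forall v, sat v phi -> sat v psi.
Proof.
elim=> {n phi psi} //=.
- by move=> n phi psi ax v; exact: axiomT_sound.
- by move=> n m s phi psi _ IH v; rewrite !sat_fsubst; exact: IH.
- by move=> n phi psi chi _ IH1 _ IH2 v /IH1/IH2.
- by move=> n t u phi v [tu]; rewrite !sat_inst tu.
- by move=> n phi psi v [].
- by move=> n phi psi v [].
- by move=> n phi psi chi _ IH1 _ IH2 v H; split; [exact: IH1|exact: IH2].
- by move=> n phi psi v; left.
- by move=> n phi psi v; right.
- by move=> n phi psi chi _ IH1 _ IH2 v [/IH1|/IH2].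
- by move=> n phi psi chi v [Hphi [H|H]]; [left|right].
- by move=> n phi psi _ IH v [a /IH]; rewrite sat_fwk.
(* The valuation is split into its initial part and its last value; the latter is the witness for
   the existential. *)
- move=> n phi psi _ IH v Hphi; rewrite -(snoc_eta v) sat_fwk.
  by apply: IH; exists (v ord_max); rewrite snoc_eta.
- by move=> n phi psi v [Hphi [a Ha]]; exists a; rewrite sat_fwk.
- move=> n t phi psi _ IH v Hpsi a lta; apply: IH.
  by rewrite sat_fwk snoc_max teval_twk.
- move=> n t phi psi _ IH v; rewrite -(snoc_eta v) sat_fwk snoc_max teval_twk.
  by move=> [Hpsi]; exact: IH.
(* IndR is ordinary induction on the last coordinate of the valuation. *)
- move=> n psi phi _ IH0 _ IHS v; rewrite -(snoc_eta v) sat_fwk => Hpsi.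
  elim: (v ord_max) => [|a IHa]; first by move/IH0: Hpsi; rewrite sat_inst.
  by rewrite -sat_inst_succ; apply: IHS; rewrite sat_fwk.
(* IndL is descent: from [psi] at a + 1 one gets [phi], or [psi] at a, and at 0 only [phi]
   remains. *)
- move=> n psi phi _ IH0 _ IHS v; rewrite -(snoc_eta v) sat_fwk.
  elim: (v ord_max) => [|a IHa] H; first by apply: IH0; rewrite sat_inst.
  move: H; rewrite -sat_inst_succ => /IHS [|/IHa] //.
  by rewrite sat_fwk.
Qed.

(** * Equational reasoning inside the theory *)

Lemma ent_from_top n (P phi : form n) : Top |-[n] phi -> P |-[n] phi.
Proof. exact: ent_cut (ent_top _). Qed.

Lemma ent_refl n (P : form n) t : P |-[n] Eq t t.
Proof. by apply: ent_from_top; exact: ent_eq_refl. Qed.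

(** Distributivity carries the side hypothesis [P] into both branches. *)
Lemma ent_or_elim n (P A B C : form n) :
  P |-[n] Or A B -> And P A |-[n] C -> And P B |-[n] C -> P |-[n] C.
Proof.
move=> PAB HA HB; apply: ent_cut (ent_or HA HB).
by apply: ent_cut (ent_distr _ _ _); apply: ent_and => //; exact: ent_id.
Qed.

(** The Frobenius axiom moves [P] under the quantifier. *)
Lemma ent_ex_elim n (P C : form n) (B : form n.+1) :
  And (fwk P) B |-[n.+1] fwk C -> And P (Ex B) |-[n] C.
Proof. by move=> H; apply: ent_cut (ent_frobenius _ _) (ent_ex H). Qed.

(** The inverse quantifier rule applied to the identity on [Ex phi] gives the generic case;
    substituting [t] for the bound variable gives the rest. *)
Lemma ent_ex_intro n (phi : form n.+1) t : inst phi t |-[n] Ex phi.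
Proof.
have := ent_subst (snoc (@Var n) t) (ent_ex_inv (ent_id (Ex phi))).
by rewrite -/(inst _ _) -/(inst _ _) inst_fwk.
Qed.

(* The arguments are replaced one at a time: at stage [k], those with index
   below [k] have been replaced. *)
Lemma ent_leibniz n m (P : form m) (phi : form n) (s r : 'I_n -> term m) :
  (forall i, P |-[m] Eq (s i) (r i)) ->
  P |-[m] fsubst s phi -> P |-[m] fsubst r phi.
Proof.
move=> sr Ps; pose hyb k (i : 'I_n) := if i < k then r i else s i.
suff H k : k <= n -> P |-[m] fsubst (hyb k) phi.
  have -> : r = hyb n; last exact: H.
  by apply: functional_extensionality => i; rewrite /hyb ltn_ord.
elim: k => [_|k IH lt_kn].
  have -> // : hyb 0 = s.
  by apply: functional_extensionality => i.
pose j := Ordinal lt_kn.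
(* Only argument [j] is abstracted, as a fresh last variable, so that the equality rule for a single
   variable applies. *)
pose phi' := fsubst (fun i => if i == j then Var ord_max else twk (hyb k i)) phi.
have instE t : inst phi' t = fsubst (fun i => if i == j then t else hyb k i) phi.
  rewrite /inst /phi' fsubst_comp; congr fsubst.
  apply: functional_extensionality => i; case: eqP => _; last exact: inst_twk.
  by rewrite /= snoc_max.
have := ent_eq_subst (s j) (r j) phi'.
have -> : inst phi' (r j) = fsubst (hyb k.+1) phi.
  rewrite instE; congr fsubst; apply: functional_extensionality => i.
  case: (eqVneq i j) => [->|ne_ij]; first by rewrite /hyb /= ltnSn.
  have ne_ik : (nat_of_ord i == k) = false by exact: negbTE.
  by rewrite /hyb ltnS [in RHS]leq_eqVlt ne_ik.
have -> : inst phi' (s j) = fsubst (hyb k) phi.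
  rewrite instE; congr fsubst; apply: functional_extensionality => i.
  by case: eqP => [->|//]; rewrite /hyb ltnn.
apply: ent_cut; exact: ent_and (sr j) (IH (ltnW lt_kn)).
Qed.

Lemma ent_app_congr n m (P : form n) (f : primrec m) ts us :
  (forall i, P |-[n] Eq (ts i) (us i)) -> P |-[n] Eq (app f ts) (app f us).
Proof.
move=> tu.
(* The first m variables stand for the arguments to be replaced, the last n are the ambient context.
   The left side is frozen at [ts], so the substitution [s ts] yields a reflexivity and [s us] the
   goal. *)
pose phi : form (m + n) :=
  Eq (app f (fun i => tsubst (fun k => Var (rshift m k)) (ts i)))
     (app f (fun i => Var (lshift n i))).
pose s (vs : 'I_m -> term n) i :=
  match split i with inl j => vs j | inr k => Var k end.
have phiE vs : fsubst (s vs) phi = Eq (app f ts) (app f vs).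
  rewrite /phi /fsubst !tsubst_app; congr (Eq (app f _) (app f _)).
    apply: functional_extensionality => i; rewrite tsubst_comp -[RHS]tsubst_id.
    congr tsubst; apply: functional_extensionality => k.
    by rewrite /= /s (unsplitK (inr k)).
  by apply: functional_extensionality => i; rewrite /= /s (unsplitK (inl i)).
rewrite -phiE; apply: (@ent_leibniz _ _ _ _ (s ts)); last first.
  by rewrite phiE; exact: ent_refl.
by move=> i; rewrite /s; case: split => // j; exact: ent_refl.
Qed.

Lemma snoc_forall n (P : 'I_n.+1 -> Prop) :
  (forall i, P (lift ord_max i)) -> P ord_max -> forall i, P i.
Proof. by move=> Pl Pm i; case: (unliftP ord_max i) => [j ->|->]. Qed.

(** Treats [Eq] and [Lt] at once: an atom that commutes with substitution is an instance of the atom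
    in two variables, to which [ent_leibniz] applies. *)
Lemma ent_atom_congr n (P : form n) (atom : forall m, term m -> term m -> form m)
    t t' u u' :
  (forall m k (s : 'I_m -> term k) a b,
     fsubst s (atom m a b) = atom k (tsubst s a) (tsubst s b)) ->
  P |-[n] Eq t t' -> P |-[n] Eq u u' -> P |-[n] atom n t u -> P |-[n] atom n t' u'.
Proof.
move=> atomE tt' uu'.
have E a b : atom n a b = fsubst (snoc (fun=> a) b) (atom 2 (Var ord0) (Var ord_max)).
  by rewrite atomE /= snoc_ord0 snoc_max.
rewrite !E; apply: ent_leibniz.
by apply: snoc_forall => [i|]; rewrite ?snoc_lift ?snoc_max.
Qed.

Lemma ent_sym n (P : form n) t u : P |-[n] Eq t u -> P |-[n] Eq u t.
Proof.
move=> tu; apply: (ent_atom_congr (atom := @Eq)) tu _ (ent_refl _ t) => //.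
exact: ent_refl.
Qed.

Lemma ent_trans n (P : form n) t u w :
  P |-[n] Eq t u -> P |-[n] Eq u w -> P |-[n] Eq t w.
Proof.
by move=> tu uw; apply: (ent_atom_congr (atom := @Eq)) (ent_refl _ _) uw tu.
Qed.

(** * Instances of the axioms *)

(** The base equation of the recursion followed by the equation of the projection. *)
Lemma ent_add0 n (P : form n) t : P |-[n] Eq (app2 PRadd t Zero) t.
Proof.
apply: ent_from_top.
have := ent_subst (fun=> t) (ent_axiom (ax_rec0 (PRproj (ord0 : 'I_1))
  (PRcomp PRsucc [ffun=> PRproj (ord_max : 'I_3)]))).
rewrite /fsubst !tsubst_app (comp_snoc (tsubst _)) /= => /ent_trans; apply.
have := ent_subst (fun=> t) (ent_axiom (ax_proj (ord0 : 'I_1))).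
by rewrite /fsubst !tsubst_app.
Qed.

Lemma ent_addS n (P : form n) t u :
  P |-[n] Eq (app2 PRadd t (Succ u)) (Succ (app2 PRadd t u)).
Proof.
apply: ent_from_top.
pose s : 'I_2 -> term n := snoc (fun=> t) u.
have := ent_subst s (ent_axiom (ax_recS (PRproj (ord0 : 'I_1))
  (PRcomp PRsucc [ffun=> PRproj (ord_max : 'I_3)]))).
rewrite /fsubst !tsubst_app !(comp_snoc (tsubst _)) tsubst_Succ tsubst_app /=.
rewrite /s snoc_max.
rewrite snocK -/s -/(app2 _ _ _) -/(app2 _ _ _) => /ent_trans; apply.
(* [r] is the triple (t, u, t + u) given to the step function of the recursion, which takes the
   successor of its last projection. *)
set r := snoc s _.
have := ent_subst r (ent_axiom (ax_comp PRsucc [ffun=> PRproj (ord_max : 'I_3)])).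
rewrite /fsubst !tsubst_app => /ent_trans; apply.
apply: ent_app_congr => i; rewrite ffunE tsubst_app /=.
have := ent_subst r (ent_axiom (ax_proj (ord_max : 'I_3))).
by rewrite /fsubst !tsubst_app /= {2}/r snoc_max.
Qed.

Lemma ent_succ_inj n (P : form n) t u :
  P |-[n] Eq (Succ t) (Succ u) -> P |-[n] Eq t u.
Proof.
have := ent_subst (snoc (fun=> t) u) (ent_axiom ax_succ_inj).
rewrite /fsubst !tsubst_Succ /= snoc_ord0 snoc_max => H H'.
exact: ent_cut H' H.
Qed.

Lemma ent_succ_neq0 n (P C : form n) t : P |-[n] Eq (Succ t) Zero -> P |-[n] C.
Proof.
have := ent_subst (fun=> t) (ent_axiom ax_succ_neq0).
rewrite /fsubst !tsubst_Succ /= => H H'.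
exact: ent_cut (ent_cut H' H) (ent_bot _).
Qed.

(** The matrix of the existential in the axioms for the order; the last variable is z in t + s z =
    u. *)
Definition lt_witness n (t u : term n) : form n.+1 :=
  Eq (app2 PRadd (twk t) (Succ (Var ord_max))) (twk u).

Lemma fsubst_lt_witness n (t u : term n) :
  fsubst (up (snoc (fun=> t) u : 'I_2 -> term n))
    (lt_witness (Var ord0) (Var ord_max)) = lt_witness t u.
Proof.
rewrite /lt_witness /fsubst tsubst_app2 !tsubst_up_twk tsubst_Succ /=.
by rewrite snoc_ord0 /up !snoc_max.
Qed.

Lemma ent_lt_ex n (t u : term n) : Lt t u |-[n] Ex (lt_witness t u).
Proof.
have := ent_subst (snoc (fun=> t) u) (ent_axiom ax_lt_ex).
by rewrite -/(lt_witness _ _) /fsubst -/fsubst fsubst_lt_witness /= snoc_ord0 snoc_max.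
Qed.

Lemma ent_lt_intro n (P : form n) (t u w : term n) :
  P |-[n] Eq (app2 PRadd t (Succ w)) u -> P |-[n] Lt t u.
Proof.
have := ent_subst (snoc (fun=> t) u) (ent_axiom ax_ex_lt).
rewrite -/(lt_witness _ _) /fsubst -/fsubst fsubst_lt_witness /= snoc_ord0 snoc_max.
move=> H Pw; apply: ent_cut H; apply: ent_cut (ent_ex_intro _ w).
by rewrite /inst /lt_witness /fsubst tsubst_app2 tsubst_Succ !inst_twk /= snoc_max.
Qed.

(** IndR proves the statement for a single variable, and substitution transfers it to [t]. *)
Lemma ent_zero_or_succ n (P : form n) (t : term n) :
  P |-[n] Or (Eq t Zero) (Ex (Eq (twk t) (Succ (Var ord_max)))).
Proof.
apply: ent_from_top.
pose phi : form 1 :=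
  Or (Eq (Var ord0) Zero) (Ex (Eq (twk (Var ord0)) (Succ (Var ord_max)))).
have phiE k (m : term k) (s : 'I_1 -> term k) : m = s ord0 ->
    fsubst s phi = Or (Eq m Zero) (Ex (Eq (twk m) (Succ (Var ord_max)))).
  by move=> ->; rewrite /phi /fsubst tsubst_up_twk tsubst_Succ /= /up snoc_max.
rewrite -(@phiE n t (fun=> t)) //.
apply: (@ent_subst _ _ _ Top); apply: (@ent_indR 0 Top).
  rewrite /inst (@phiE _ Zero) ?snoc1 //.
  exact: ent_cut (ent_eq_refl _) (ent_or_l _ _).
rewrite /inst_succ (@phiE _ (Succ (Var ord_max))) ?snoc1 //.
(* The predecessor of s y is y itself. *)
apply: ent_cut (ent_or_r _ _); apply: ent_cut (ent_ex_intro _ (Var ord_max)).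
rewrite /inst /fsubst inst_twk tsubst_Succ /= snoc_max; exact: ent_refl.
Qed.

(** * Completeness *)

Fixpoint num (n k : nat) : term n := if k is k'.+1 then Succ (num n k') else Zero.

Lemma tsubst_num n m (s : 'I_n -> term m) k : tsubst s (num n k) = num m k.
Proof. by elim: k => [//|k IH]; rewrite (tsubst_Succ s (num n k)) IH. Qed.

(** A witness z would give s (t + z) = t + s z = 0. *)
Lemma ent_lt_num0 n (P C : form n) t : P |-[n] Lt t (num n 0) -> P |-[n] C.
Proof.
move=> H; apply: ent_cut H _; apply: ent_cut (ent_lt_ex _ _) _; apply: ent_ex.
apply: ent_succ_neq0; apply: ent_trans (ent_sym (ent_addS _ _ _)) (ent_id _).
Qed.

(** From t + s w = s k follows t + w = k. If w = 0 then t = k; if w = s z then z witnesses t < k. *)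
Lemma ent_lt_numS n (t : term n) k :
  Lt t (num n k.+1) |-[n] Or (Lt t (num n k)) (Eq t (num n k)).
Proof.
apply: ent_cut (ent_lt_ex _ _) _; apply: ent_ex.
rewrite /lt_witness /twk tsubst_num -/(twk t) /fwk /fsubst tsubst_num -/(twk t).
set w := Var _; set P := Eq _ _.
have Hk : P |-[n.+1] Eq (app2 PRadd (twk t) w) (num n.+1 k).
  apply: ent_succ_inj; apply: ent_trans (ent_sym (ent_addS _ _ _)) (ent_id _).
apply: ent_or_elim (ent_zero_or_succ _ w) _ _.
  apply: ent_cut (ent_or_r _ _); apply: ent_trans (ent_cut (ent_and_l _ _) Hk).
  apply: ent_trans (ent_sym (ent_add0 _ _)) _.
  apply: ent_app_congr; apply: snoc_forall => [i|]; rewrite ?snoc_lift ?snoc_max.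
    exact: ent_refl.
  apply: ent_sym; exact: ent_and_r.
apply: ent_ex_elim; rewrite /fwk /= -!/(twk _) /twk !tsubst_num -!/(twk _).
apply: ent_cut (ent_or_l _ _); apply: (@ent_lt_intro _ _ _ _ (Var ord_max)).
(* [Hk] is moved to the context that also contains the predecessor of [w]. *)
have := ent_subst (@wkvar _) Hk; rewrite /fsubst tsubst_app2 tsubst_num -!/(twk _).
move/(ent_cut (ent_and_l _ _)) => Hk'; apply: ent_trans (Hk' _).
apply: ent_app_congr; apply: snoc_forall => [i|]; rewrite ?snoc_lift ?snoc_max.
  exact: ent_refl.
apply: ent_sym; exact: ent_and_r.
Qed.

(** Induction on [k] outside the theory, splitting off the largest case by [ent_lt_numS]. *)
Lemma ent_lt_num_cases (phi : form 1) k :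
  (forall a, a < k -> Top |-[0] inst phi (num 0 a)) ->
  Lt (Var ord_max) (num 1 k) |-[1] phi.
Proof.
elim: k => [_|k IH H]; first exact: ent_lt_num0 (ent_id _).
apply: ent_cut (ent_lt_numS _ _) _; apply: ent_or.
  by apply: IH => a ak; apply: H; exact: ltnW.
(* With [phi] written as its own identity substitution, the hypothesis that the variable equals the
   numeral [k] reduces the goal to the closed instance at [k]. *)
rewrite -[X in _ |-[_] X]fsubst_id.
apply: (@ent_leibniz _ _ _ _ (fun=> num 1 k)).
  move=> i; rewrite (ord1_max i); apply: ent_sym; exact: ent_id.
apply: ent_from_top; have := ent_subst (@wkvar 0) (H k (ltnSn k)).
rewrite /inst fsubst_comp /=; congr (entails _ (fsubst _ _)).
apply: functional_extensionality => i.
by rewrite snoc1 tsubst_num.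
Qed.

Lemma ent_PReval m (f : primrec m) : forall n (v : 'I_m -> nat),
  Top |-[n] Eq (app f (fun i => num n (v i))) (num n (PReval f v)).
Proof.
elim/primrec_nested_ind: f => {m}.
- move=> n v; have := ent_subst (fun=> num n (v ord0)) (ent_axiom ax_zero).
  rewrite /fsubst tsubst_app1 /= /app1; congr (entails _ (Eq (app _ _) _)).
  by apply: functional_extensionality => i; rewrite ord1.
- move=> n v /=; rewrite /Succ /app1.
  by apply: ent_app_congr => i; rewrite ord1; exact: ent_refl.
- move=> m k n v.
  have := ent_subst (fun i => num n (v i)) (ent_axiom (ax_proj k)).
  by rewrite /fsubst tsubst_app.
- move=> m l h g IHh IHg n v.
  have := ent_subst (fun i => num n (v i)) (ent_axiom (ax_comp h g)).
  rewrite /fsubst !tsubst_app => /ent_trans; apply.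
  apply: ent_trans (IHh n _); apply: ent_app_congr => i.
  by rewrite tsubst_app; exact: IHg.
(* The recursion argument is separated from the parameters [x], and an inner induction on its value
   runs outside the theory. *)
- move=> m g h IHg IHh n v; rewrite -(snoc_eta v).
  move: (fun i => v _) (v ord_max) => x; elim=> [|k IH].
    have := ent_subst (fun i => num n (x i)) (ent_axiom (ax_rec0 g h)).
    rewrite /fsubst !tsubst_app (comp_snoc (tsubst _)) (comp_snoc (num n)).
    by move/ent_trans; apply; rewrite PReval_rec0; exact: IHg.
  rewrite PReval_recS (comp_snoc (num n)).
  have := ent_subst (fun i => num n (snoc x k i)) (ent_axiom (ax_recS g h)).
  rewrite /fsubst !tsubst_app !(comp_snoc (tsubst _)) tsubst_Succ tsubst_app.
  have -> : (fun i => tsubst (fun j => num n (snoc x k j)) (wkvar i)) =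
      (fun i => num n (x i)).
    by apply: functional_extensionality => i; rewrite /= snoc_lift.
  rewrite [tsubst _ (Var ord_max)]/= snoc_max => /ent_trans; apply.
  apply: ent_trans (IHh n _).
  apply: ent_app_congr; apply: snoc_forall => [i|]; rewrite ?snoc_lift ?snoc_max //.
  exact: ent_refl.
Qed.

Lemma ent_teval n m (v : 'I_n -> nat) (t : term n) :
  Top |-[m] Eq (tsubst (fun i => num m (v i)) t) (num m (teval v t)).
Proof.
elim/term_nested_ind: t => [i||k f ts IH] /=; [exact: ent_refl..|].
apply: ent_trans (ent_PReval f m _); rewrite app_ffun.
by apply: ent_app_congr => i; rewrite ffunE.
Qed.

Lemma ent_lt_num n a b : a < b -> Top |-[n] Lt (num n a) (num n b).
Proof.
(* The witness enters through its successor, so b - (a + 1) is the right value: a + s (b - (a + 1))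
   = b. *)
move=> ab; apply: (@ent_lt_intro _ _ _ _ (num n (b - a.+1))).
have := ent_PReval PRadd n (snoc (fun=> a) (b - a.+1).+1).
by rewrite PReval_PRadd snoc_ord0 snoc_max (comp_snoc (num n)) addnS -addSn subnKC.
Qed.

(** Stated for open formulas and all valuations, since under a quantifier the induction needs the
    valuation extended by an arbitrary value. *)
Lemma sat_provable n (phi : form n) : forall v : 'I_n -> nat,
  sat v phi -> provable (fsubst (fun i => num 0 (v i)) phi).
Proof.
rewrite /provable; elim: phi => {n} /=.
- by move=> n v _; exact: ent_top.
- by [].
- move=> n t u v tu; apply: ent_trans (ent_teval _ _ _) _; rewrite tu.
  apply: ent_sym; exact: ent_teval.
- move=> n t u v /(ent_lt_num 0); apply: (ent_atom_congr (atom := @Lt)) => //;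
  apply: ent_sym; exact: ent_teval.
- by move=> n phi IH1 psi IH2 v [/IH1 H1 /IH2 H2]; exact: ent_and.
- move=> n phi IH1 psi IH2 v [/IH1|/IH2] H.
    exact: ent_cut H (ent_or_l _ _).
  exact: ent_cut H (ent_or_r _ _).
- move=> n phi IH v [a /IH]; rewrite (comp_snoc (num 0)) -inst_up => H.
  exact: ent_cut H (ent_ex_intro _ _).
- move=> n t phi IH v H; apply: ent_ball.
  (* The bound is first exchanged for the numeral of its value, so that the case analysis below a
     numeral applies; the exchange is justified by [ent_teval], weakened to the context of the bound
     variable. *)
  apply: (@ent_cut _ _ (Lt (Var ord_max) (num 1 (teval v t)))); last first.
    apply: ent_lt_num_cases => a /H /IH.
    by rewrite (comp_snoc (num 0)) -inst_up.
  apply: (ent_atom_congr (atom := @Lt)) (ent_refl _ _) _ (ent_and_r _ _) => //.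
  apply: ent_from_top; have := ent_subst (@wkvar 0) (ent_teval 0 v t).
  by rewrite /fsubst tsubst_num.
Qed.

Theorem theorem7p3 (phi : sentence) : provable phi <-> true_in_N phi.
Proof.
split; first by move=> /entails_sound; apply.
move=> /sat_provable; rewrite -{2}(fsubst_id phi); congr (provable (fsubst _ _)).
(* The numeral substitution and the identity are both indexed by the empty type ['I_0], hence
   equal. *)
by apply: functional_extensionality => -[].
Qed.
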